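(* Let $\mathbf P=(P,\leq,{}',0,1)$ be a bounded poset with an antitone involution. Then $\mathbf P$ is not paraorthomodular if and only if it contains a strong subposet $\mathbf M$ that is ortho-isomorphic to $\mathbf B_6$.
   Context: A bounded poset with an antitone involution is $(P,\leq,{}',0,1)$ where $(P,\leq)$ is a poset with least element $0$ and greatest element $1$, $x''=x$ for all $x$, and $x\leq y$ implies $y'\leq x'$. For $A\subseteq P$ put $L(A)=\{x\in P\mid x\leq y\text{ for all }y\in A\}$ and $U(A)=\{x\in P\mid x\geq y\text{ for all }y\in A\}$; write $L(a,b)$ for $L(\{a,b\})$, $UL(A)$ for $U(L(A))$, etc. $\mathbf P$ is paraorthomodular if for all $x,y\in P$: $x\leq y$ and $L(x',y)=\{0\}$ imply $x=y$. For a subset $A\subseteq P$ (with the inherited order) and $x,y\in A$, let $L_{\mathbf A}(x,y)$, $U_{\mathbf A}(x,y)$ be the sets of common lower, respectively upper, bounds of $x,y$ lying in $A$, and let $L_{\mathbf P}, U_{\mathbf P}$ denote lower and upper cones computed in $P$. A strong subset (strong subposet) of $\mathbf P$ is a subset $A\subseteq P$ containing $0$ and $1$ such that $x'\in A$ for every $x\in A$ and, for all $x,y\in A$, $U_{\mathbf P}L_{\mathbf A}(x,y)=U_{\mathbf P}L_{\mathbf P}(x,y)$ and $L_{\mathbf P}U_{\mathbf A}(x,y)=L_{\mathbf P}U_{\mathbf P}(x,y)$. It is regarded as a bounded poset with the inherited order and involution. $\mathbf B_6$ is the bounded poset with antitone involution having the six distinct elements $0,a,b,a',b',1$, whose order is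 given by $0<a<b<1$ and $0<b'<a'<1$, with no other comparabilities (the benzene ring), and whose involution exchanges $0\leftrightarrow1$, $a\leftrightarrow a'$, $b\leftrightarrow b'$. An ortho-isomorphism is an order isomorphism commuting with the involutions. *)

(* Defs.v *)
From HB Require Import structures.
From mathcomp Require Import all_boot all_order.
From mathcomp Require Import boolp classical_sets.

Set Implicit Arguments.
Unset Strict Implicit.
Unset Printing Implicit Defensive.

Import Order.TTheory.
Local Open Scope classical_set_scope.
Local Open Scope order_scope.

HB.mixin Record hasAntitoneInvolution (d : Order.disp_t) P
    of Order.TBPOrder d P := {
  ainv : P -> P;
  ainvK : involutive ainv;
  le_ainv : {homo ainv : x y /~ x <= y};
}.

#[short(type="invTBPOrderType")]
HB.structure Definition InvTBPOrder (d : Order.disp_t) :=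
  { P of Order.TBPOrder d P & hasAntitoneInvolution d P }.

(* The cones L(A) and U(A) are the library's [lbound A] and [ubound A]. *)

Definition paraorthomodular (d : Order.disp_t) (P : invTBPOrderType d) : Prop :=
  forall x y : P, x <= y -> lbound [set ainv x; y] = [set \bot] -> x = y.

Record strong_subset (d : Order.disp_t) (P : invTBPOrderType d) (A : set P)
    : Prop := StrongSubset {
  strong_bot : A \bot;
  strong_top : A \top;
  strong_inv : forall x, A x -> A (ainv x);
  strong_UL : forall x y, A x -> A y ->
    ubound (lbound [set x; y] `&` A) = ubound (lbound [set x; y]);
  strong_LU : forall x y, A x -> A y ->
    lbound (ubound [set x; y] `&` A) = lbound (ubound [set x; y]);
}.

Record strongSubposet (d : Order.disp_t) (P : invTBPOrderType d) :=
  StrongSubposet {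
    strong_carrier : set P;
    strong_carrierP : strong_subset strong_carrier;
  }.

Definition strong_sort (d : Order.disp_t) (P : invTBPOrderType d)
  (M : strongSubposet P) : Type := set_type (strong_carrier M).

Coercion strong_sort : strongSubposet >-> Sortclass.

Section StrongSubposetStructure.
Context (d : Order.disp_t) (P : invTBPOrderType d) (M : strongSubposet P).

HB.instance Definition _ := SubChoice.on (strong_sort M).
HB.instance Definition _ :=
  [SubChoice_isSubPOrder of strong_sort M by <: with d].

Let M_bot : strong_sort M :=
  exist _ \bot (mem_set (strong_bot (strong_carrierP M))).
Let M_top : strong_sort M :=
  exist _ \top (mem_set (strong_top (strong_carrierP M))).
Let M_inv (x : strong_sort M) : strong_sort M :=
  exist _ (ainv (val x))
    (mem_set (strong_inv (strong_carrierP M) (set_mem (valP x)))).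

Fact strong_le0x (x : strong_sort M) : M_bot <= x.
Proof. by rewrite -Order.le_val /= le0x. Qed.

Fact strong_lex1 (x : strong_sort M) : x <= M_top.
Proof. by rewrite -Order.le_val /= lex1. Qed.

HB.instance Definition _ := Order.hasBottom.Build d (strong_sort M) strong_le0x.
HB.instance Definition _ := Order.hasTop.Build d (strong_sort M) strong_lex1.

Fact strong_invK : involutive M_inv.
Proof. by move=> x; apply: val_inj; rewrite /= ainvK. Qed.

Fact strong_le_inv : {homo M_inv : x y /~ x <= y}.
Proof. by move=> x y; rewrite -!Order.le_val /=; apply: le_ainv. Qed.

HB.instance Definition _ :=
  hasAntitoneInvolution.Build d (strong_sort M) strong_invK strong_le_inv.

End StrongSubposetStructure.

Definition ortho_isomorphic (d1 d2 : Order.disp_t)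
    (P : invTBPOrderType d1) (Q : invTBPOrderType d2) : Prop :=
  exists f : P -> Q,
    [/\ bijective f, {mono f : x y / x <= y} & {morph f : x / ainv x}].

(* [B6ac] and [B6bc] are the involution images a' and b' of a and b. *)
Inductive B6 : Type := B60 | B6a | B6b | B6ac | B6bc | B61.

Definition B6_code (x : B6) : 'I_6 :=
  inord (match x with
         | B60 => 0 | B6a => 1 | B6b => 2 | B6ac => 3 | B6bc => 4 | B61 => 5
         end)%N.

Definition B6_decode (i : 'I_6) : B6 :=
  nth B60 [:: B60; B6a; B6b; B6ac; B6bc; B61] i.

Fact B6_codeK : cancel B6_code B6_decode.
Proof. by case; rewrite /B6_decode inordK. Qed.

HB.instance Definition _ := Finite.copy B6 (can_type B6_codeK).

Definition B6_le (x y : B6) : bool :=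
  match x, y with
  | B60, _ | _, B61 => true
  | B6a, (B6a | B6b) | B6b, B6b => true
  | B6bc, (B6bc | B6ac) | B6ac, B6ac => true
  | _, _ => false
  end.

Definition B6_inv (x : B6) : B6 :=
  match x with
  | B60 => B61 | B6a => B6ac | B6b => B6bc
  | B6ac => B6a | B6bc => B6b | B61 => B60
  end.

Fact B6_le_refl : reflexive B6_le. Proof. by case. Qed.

Fact B6_le_anti : antisymmetric B6_le. Proof. by case; case. Qed.

Fact B6_le_trans : transitive B6_le. Proof. by case; case; case. Qed.

Fact B6_display : Order.disp_t. Proof. exact: (Order.Disp tt tt). Qed.

HB.instance Definition _ :=
  Order.Le_isPOrder.Build B6_display B6 B6_le_refl B6_le_anti B6_le_trans.

Fact B6_le0x (x : B6) : B60 <= x. Proof. by []. Qed.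

Fact B6_lex1 (x : B6) : x <= B61. Proof. by case: x. Qed.

HB.instance Definition _ := Order.hasBottom.Build B6_display B6 B6_le0x.
HB.instance Definition _ := Order.hasTop.Build B6_display B6 B6_lex1.

Fact B6_invK : involutive B6_inv. Proof. by case. Qed.

Fact B6_le_inv : {homo B6_inv : x y /~ x <= y}. Proof. by case; case. Qed.

HB.instance Definition _ :=
  hasAntitoneInvolution.Build B6_display B6 B6_invK B6_le_inv.

(* Main.v *)
Require Import Defs.
From HB Require Import structures.
From mathcomp Require Import all_boot all_order.
From mathcomp Require Import boolp classical_sets.

(** A failure of paraorthomodularity is a pair [x < y] with
    [L(x', y) = {0}].  Such a pair spans a benzene ring
    [{0, x, y, x', y', 1}]: any comparability beyond those of [B6] would force
    [x = 0] or [y = 1], and either one collapses [x = y] ([B6_map_le]).  This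
    ring is automatically a strong subset ([B6_map_strong]).  Two of its elements
    are either comparable, in which case their smaller one generates both lower
    cones, or one lies below [x'] and the other below [y], so that their lower
    cone in [P] is already [{0}]; upper cones follow by applying the involution
    ([strong_subset_of_UL]).

    Conversely, in a strong copy of [B6] the lower cone of [a'] and [b] computed
    inside the copy is [{0}].  Its upper cone in [P] is then all of [P], so by
    strength [0] bounds [L(a', b)] from above: [L(a', b) = {0}] in [P] although
    [a < b]. *)

Set Implicit Arguments.
Unset Strict Implicit.
Unset Printing Implicit Defensive.

Import Order.TTheory.
Local Open Scope classical_set_scope.
Local Open Scope order_scope.

Section Cones.
Context (d : Order.disp_t) (P : invTBPOrderType d).
Implicit Types (x y z : P) (A : set P).

Lemma lbound2P x y z : lbound [set x; y] z <-> z <= x /\ z <= y.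
Proof.
split=> [zL|[zx zy] t [->|->] //].
by split; apply: zL; [left|right].
Qed.

Lemma ubound2P x y z : ubound [set x; y] z <-> x <= z /\ y <= z.
Proof.
split=> [zU|[xz yz] t [->|->] //].
by split; apply: zU; [left|right].
Qed.

Lemma lbound2_eq_botP x y :
  lbound [set x; y] = [set \bot] <->
  (forall z, z <= x -> z <= y -> z = \bot).
Proof.
split=> [L0 z zx zy|L0].
  by have : lbound [set x; y] z; [apply/lbound2P|rewrite L0].
apply/seteqP; split=> [z /lbound2P[]|z ->]; first exact: L0.
by apply/lbound2P; rewrite !le0x.
Qed.

Lemma ainv_le x y : (ainv x <= ainv y) = (y <= x).
Proof.
by apply/idP/idP => [/(@le_ainv _ P)|/(@le_ainv _ P)//]; rewrite !ainvK.
Qed.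

Lemma ainv_bot : ainv (\bot : P) = \top.
Proof. by apply/le_anti; rewrite lex1 -ainv_le ainvK le0x. Qed.

Lemma ainv_top : ainv (\top : P) = \bot.
Proof. by rewrite -ainv_bot ainvK. Qed.

(** The involution exchanges lower and upper cones and preserves [A], so half of
    the cone conditions yields the other half; in each equality the inclusion
    from right to left holds for every [A]. *)
Lemma strong_subset_of_UL A :
  A \bot -> (forall x, A x -> A (ainv x)) ->
  (forall x y, A x -> A y ->
    ubound (lbound [set x; y] `&` A) `<=` ubound (lbound [set x; y])) ->
  strong_subset A.
Proof.
move=> A0 Ainv AUL; split=> //.
- by rewrite -ainv_bot; exact: Ainv.
- move=> x y Ax Ay; apply/seteqP; split; first exact: AUL.
  by move=> w wU t [/wU].
- move=> x y Ax Ay; apply/seteqP; split; last by move=> w wL t [/wL].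
  move=> w wL z /ubound2P[xz yz]; rewrite -ainv_le.
  apply: (AUL (ainv x) (ainv y)); [exact: Ainv|exact: Ainv| |]; last first.
    by apply/lbound2P; rewrite !ainv_le.
  move=> t [/lbound2P[tx ty] At]; rewrite -ainv_le ainvK.
  apply: wL; split; last exact: Ainv.
  by apply/ubound2P; rewrite -(ainvK x) -(ainvK y) !ainv_le.
Qed.

End Cones.

Lemma ortho_isomorphic_range (d1 d2 : Order.disp_t) (P : invTBPOrderType d1)
    (Q : invTBPOrderType d2) (f : Q -> P) (Sf : strong_subset (range f)) :
  {mono f : u v / u <= v} -> {morph f : u / ainv u} ->
  ortho_isomorphic (StrongSubposet Sf : strongSubposet P) Q.
Proof.
move=> fle finv; set M := StrongSubposet Sf.
have f_inj : injective f.
  by move=> u v fuv; apply/le_anti; rewrite -!fle fuv lexx.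
have preim (m : M) : {u : Q | f u = val m}.
  by apply: cid; case: (set_mem (valP m)) => u _ fu; exists u.
pose g m := sval (preim m).
have fg m : f (g m) = val m := svalP (preim m).
exists g; split.
- exists (fun u : Q => exist _ (f u) (mem_set (imageT f u)) : M).
    by move=> m; apply: val_inj; rewrite /= fg.
  by move=> u; apply: f_inj; rewrite fg.
- by move=> m n; rewrite -fle !fg Order.le_val.
- by move=> m; apply: f_inj; rewrite finv !fg.
Qed.

(** Every non-comparability of [B6] is a consequence of one of four, so a
    monotone map out of [B6] reflects the order as soon as it respects these. *)
Lemma B6_nleP (u v : B6) : ~~ (u <= v) ->
  [|| (B6a <= u) && (v <= B6ac), (B6b <= u) && (v <= B6a),
      (B6bc <= u) && (v <= B6b) | (B6ac <= u) && (v <= B6bc)].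
Proof. by case: u; case: v. Qed.

(** The reason why the one condition [L(x', y) = {0}] controls the lower cones of
    all incomparable pairs of the ring: each lies below the pair [a'], [b]. *)
Lemma B6_compareP (u v : B6) :
  [|| u <= v, v <= u, (u <= B6ac) && (v <= B6b) | (u <= B6b) && (v <= B6ac)].
Proof. by case: u; case: v. Qed.

Section BenzeneRing.
Context (d : Order.disp_t) (P : invTBPOrderType d) (x y : P).

Definition B6_map (u : B6) : P :=
  match u with
  | B60 => \bot | B6a => x | B6b => y
  | B6ac => ainv x | B6bc => ainv y | B61 => \top
  end.

Lemma B6_map_inv : {morph B6_map : u / ainv u}.
Proof. by case; rewrite /= ?ainvK ?ainv_bot ?ainv_top. Qed.

Hypotheses (le_xy : x <= y) (neq_xy : x <> y).
Hypothesis L0 : lbound [set ainv x; y] = [set \bot].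

Let disj z : z <= ainv x -> z <= y -> z = \bot.
Proof. exact: (lbound2_eq_botP (ainv x) y).1. Qed.

(** [x = 0] would give [x' = 1], so that [y] itself lies in [L(x', y)]. *)
Let x_neq0 : x <> \bot.
Proof.
move=> x0; apply: neq_xy; rewrite x0; apply/esym/disj => //.
by rewrite x0 ainv_bot lex1.
Qed.

(** [y = 1] would put [x'] in [L(x', y)], whence [x' = 0] and [x = 1]. *)
Let y_neq1 : y <> \top.
Proof.
move=> y1; apply: neq_xy; rewrite y1 -(ainvK x) (@disj (ainv x)) //.
  by rewrite ainv_bot.
by rewrite y1 lex1.
Qed.

Lemma B6_map_le : {mono B6_map : u v / u <= v}.
Proof.
have homo_f (u v : B6) : u <= v -> B6_map u <= B6_map v.
  by case: u; case: v => //= _; rewrite ?le0x ?lex1 ?ainv_le.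
have nle_yx : ~ y <= x by move=> le_yx; apply/neq_xy/le_anti/andP.
move=> u v; apply/idP/idP; last exact: homo_f.
apply: contraLR => /B6_nleP nle_uv; apply/negP => fuv.
have between s t : s <= u -> v <= t -> B6_map s <= B6_map t.
  by move=> /homo_f su /homo_f vt; apply: le_trans (le_trans fuv vt).
case/or4P: nle_uv => /andP[/between su /su /= st].
- by apply/x_neq0/disj.
- exact: nle_yx.
- apply: y_neq1; rewrite -(ainvK y) (@disj (ainv y)) ?ainv_bot //.
  by rewrite ainv_le.
- by apply: nle_yx; rewrite -ainv_le.
Qed.

Lemma B6_map_strong : strong_subset (range B6_map).
Proof.
apply: strong_subset_of_UL; first by exists B60.
  by move=> _ [u _ <-]; rewrite -B6_map_inv; apply: imageT.
move=> _ _ [u _ <-] [v _ <-] w wU z /lbound2P[zu zv].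
(* A lower bound lying in the ring and above [z] transfers the bound [w]. *)
suff [t [tu tv zt]] : exists t, [/\ t <= u, t <= v & z <= B6_map t].
  apply: le_trans zt _; apply: wU; split; last exact: imageT.
  by apply/lbound2P; rewrite !B6_map_le.
have bot_case : z = \bot -> exists t, [/\ t <= u, t <= v & z <= B6_map t].
  by move=> ->; exists B60; rewrite !le0x.
have le_f (s t : B6) : s <= t -> z <= B6_map s -> z <= B6_map t.
  by move=> st zs; apply: le_trans zs _; rewrite B6_map_le.
case/or4P: (B6_compareP u v) => [uv|vu|/andP[ub va]|/andP[ub va]].
- by exists u.
- by exists v.
- exact/bot_case/disj/(le_f _ _ va)/zv/(le_f _ _ ub)/zu.
- exact/bot_case/disj/(le_f _ _ ub)/zu/(le_f _ _ va)/zv.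
Qed.

End BenzeneRing.

(** A lower cone reduced to [0] inside [A] has all of [P] as its upper cone, in
    particular [0]; strength makes [0] an upper bound of the full lower cone. *)
Lemma strong_lbound2_eq_bot (d : Order.disp_t) (P : invTBPOrderType d)
    (A : set P) (x y : P) : strong_subset A -> A x -> A y ->
  lbound [set x; y] `&` A `<=` [set \bot] -> lbound [set x; y] = [set \bot].
Proof.
move=> SA Ax Ay LA0; apply/lbound2_eq_botP => z zx zy.
have : ubound (lbound [set x; y]) \bot.
  by rewrite -(strong_UL SA) // => t /LA0 ->.
move=> /(_ z); rewrite lex0 => z0.
by apply/eqP/z0/lbound2P.
Qed.

Lemma B6_not_paraorthomodular (d : Order.disp_t) (P : invTBPOrderType d)
    (M : strongSubposet P) : ortho_isomorphic M B6 -> ~ paraorthomodular P.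
Proof.
move=> [f [[g gK fK] fle finv]] paraP.
have gle u v : (g u <= g v) = (u <= v) by rewrite -fle !fK.
have g_inv u : g (ainv u) = ainv (g u) by rewrite -[RHS]gK finv fK.
have MA (m : M) : strong_carrier M (val m) := set_mem (valP m).
have ab : val (g B6a) = val (g B6b).
  apply: paraP; first by rewrite Order.le_val gle.
  have -> : ainv (val (g B6a)) = val (g B6ac) by rewrite (g_inv B6a).
  apply: (strong_lbound2_eq_bot (strong_carrierP M)) => //.
  move=> z [/lbound2P[zac zb] Az].
  pose m : M := exist _ z (mem_set Az).
  have mac : f m <= B6ac by rewrite -(fK B6ac) fle -Order.le_val.
  have mb : f m <= B6b by rewrite -(fK B6b) fle -Order.le_val.
  have m0 : m <= \bot.
    by rewrite -fle; case: (f m) mac mb.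
  by apply/eqP; rewrite -lex0; move: m0; rewrite -Order.le_val.
by have := gle B6b B6a; rewrite -(val_inj ab) lexx.
Qed.

Theorem theorem2p5 (d : Order.disp_t) (P : invTBPOrderType d) :
  ~ paraorthomodular P <-> exists M : strongSubposet P, ortho_isomorphic M B6.
Proof.
split=> [nparaP|[M]]; last exact: B6_not_paraorthomodular.
have [x [y [xy L0 neq_xy]]] :
    exists x y : P, [/\ x <= y, lbound [set ainv x; y] = [set \bot] & x <> y].
  apply: contrapT => nxy; apply: nparaP => x y xy L0.
  by apply: contrapT => neq_xy; apply: nxy; exists x, y.
exists (StrongSubposet (B6_map_strong xy neq_xy L0)).
apply: ortho_isomorphic_range; first exact: B6_map_le.
exact: B6_map_inv.
Qed.
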